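(* Let $A$ and $B$ be densely defined operators in a Hilbert space such that $A$, $B$ and $AB$ are closeable. If $\overline{B}$ is $\overline{A}\,\overline{B}$-bounded, then $\overline{A}\,\overline{B}$ is closed and $\overline{AB}\subset\overline{A}\,\overline{B}$.
   Context: Operators are linear, defined on linear subspaces (domains) $D(\cdot)$ of a Hilbert space, and not necessarily bounded. $S\subset T$ means that $T$ extends $S$. Products carry their natural domains, e.g. $D(AB)=\{x\in D(B): Bx\in D(A)\}$. $\overline{T}$ denotes the closure of a closeable operator $T$. An operator $S$ is $T$-bounded (relatively bounded with respect to $T$) if $D(T)\subset D(S)$ and there are constants $a,b\ge 0$ with $\|Sx\|\le a\|x\|+b\|Tx\|$ for all $x\in D(T)$. *)

(* Defs.v *)
From HB Require Import structures.
From mathcomp Require Import all_boot all_order all_algebra.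
From mathcomp Require Import all_classical all_reals all_analysis.
From mathcomp Require Import complex.

Set Implicit Arguments.
Unset Strict Implicit.
Unset Printing Implicit Defensive.

Import Order.TTheory GRing.Theory Num.Theory.
Import numFieldNormedType.Exports.

Local Open Scope classical_set_scope.
Local Open Scope ring_scope.

(* The scalars of a Hilbert space: the reals or the complex numbers. *)
Variant scalar_kind := RealScalars | ComplexScalars.

Definition scalar_field (R : realType) (k : scalar_kind) : numFieldType :=
  match k with
  | RealScalars => R
  | ComplexScalars => R[i]
  end.

Definition scalar_conj (R : realType) (k : scalar_kind) :
    scalar_field R k -> scalar_field R k :=
  match k with
  | RealScalars => fun x : R => x
  | ComplexScalars => fun z : R[i] => z^*
  end.

(* A complete normed space is a Hilbert space when its norm comes from an inner
   product (here linear in the first argument). *)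
Definition inner_product_norm (R : realType) (k : scalar_kind)
    (H : normedModType (scalar_field R k))
    (dot : {dot H for @scalar_conj R k}) :=
  forall x : H, dot x x = `|x| ^+ 2.

Section Operators.
Variables (K : numFieldType) (H : normedModType K).

(* A linear map from the subspace op_dom to H; op_fun takes arbitrary values
   outside op_dom, which is why graphs and inclusions are restricted to it. *)
Record operator := Operator {
  op_dom : set H ;
  op_fun :> H -> H ;
  op_dom0 : op_dom 0 ;
  op_domD : forall (a : K) (x y : H), op_dom x -> op_dom y ->
    op_dom (a *: x + y) ;
  op_fun_linear : forall (a : K) (x y : H), op_dom x -> op_dom y ->
    op_fun (a *: x + y) = a *: op_fun x + op_fun y }.

Implicit Types S T : operator.

Definition graph T : set (H * H) :=
  [set p | op_dom T p.1 /\ T p.1 = p.2].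

Definition densely_defined T := dense (op_dom T).

Definition op_sub S T :=
  op_dom S `<=` op_dom T /\ (forall x, op_dom S x -> S x = T x).

Definition closed_op T := closed (graph T).

Definition closeable T := exists S, closed_op S /\ op_sub T S.

(* S is T-bounded. The order on complex scalars makes 0 <= a imply that a is
   real, so a and b are nonnegative real numbers in both cases. *)
Definition op_bounded_by S T :=
  op_dom T `<=` op_dom S /\
  exists a b : K, [/\ 0 <= a, 0 <= b &
    forall x, op_dom T x -> `|S x| <= a * `|x| + b * `|T x|].

Lemma op_fun0 T : T 0 = 0.
Proof.
have := op_fun_linear (- 1) (op_dom0 T) (op_dom0 T).
by rewrite scaler0 addr0 scaleN1r addNr.
Qed.

Definition mul_dom S T : set H := [set x | op_dom T x /\ op_dom S (T x)].

Lemma mul_dom0 S T : mul_dom S T 0.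
Proof. by rewrite /mul_dom /= op_fun0; split; exact: op_dom0. Qed.

Lemma mul_domD S T (a : K) (x y : H) :
  mul_dom S T x -> mul_dom S T y -> mul_dom S T (a *: x + y).
Proof.
move=> [Tx STx] [Ty STy]; split; first exact: op_domD.
by rewrite op_fun_linear //; exact: op_domD.
Qed.

Lemma mul_fun_linear S T (a : K) (x y : H) :
  mul_dom S T x -> mul_dom S T y ->
  S (T (a *: x + y)) = a *: S (T x) + S (T y).
Proof. by move=> [Tx STx] [Ty STy]; rewrite !op_fun_linear. Qed.

Definition op_mul S T : operator :=
  @Operator (mul_dom S T) (fun x => S (T x)) (mul_dom0 S T)
    (@mul_domD S T) (@mul_fun_linear S T).

Definition closure_dom T : set H :=
  [set x | exists y, closure (graph T) (x, y)].

Definition closure_fun T (x : H) : H :=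
  xget 0 [set y | closure (graph T) (x, y)].

Lemma graph_closure_lin T (a : K) (p q : H * H) :
  closure (graph T) p -> closure (graph T) q ->
  closure (graph T) (a *: p + q).
Proof.
move=> Tp Tq B /= nB.
have /(_ _ nB)[[U V] /= [nU nV] UV] :
    {for (p, q), continuous (fun z : (H * H) * (H * H) => a *: z.1 + z.2)}.
  apply: continuousD; last exact: cvg_snd.
  by apply: continuousZl_tmp; exact: cvg_fst.
have [[x x'] [[/= Tx <-] Ux]] := Tp _ nU.
have [[y y'] [[/= Ty <-] Vy]] := Tq _ nV.
exists (a *: x + y, a *: T x + T y); split.
  by split => /=; [exact: op_domD|exact: op_fun_linear].
exact: (UV ((x, T x), (y, T y))).
Qed.

Lemma closure_dom0 T : closure_dom T 0.
Proof.
exists 0; apply: subset_closure.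
by split; [exact: op_dom0|exact: op_fun0].
Qed.

Lemma closure_domD T (a : K) (x y : H) :
  closure_dom T x -> closure_dom T y -> closure_dom T (a *: x + y).
Proof.
move=> [x' Tx] [y' Ty]; exists (a *: x' + y').
exact: (graph_closure_lin (a := a) Tx Ty).
Qed.

Lemma closeable_functional T : closeable T -> forall x y z,
  closure (graph T) (x, y) -> closure (graph T) (x, z) -> y = z.
Proof.
move=> [S [cS [TS eTS]]] x y z.
have sub : closure (graph T) `<=` graph S.
  apply: subset_trans cS; apply: closureS => -[u v] [/= Tu <-].
  by split => /=; [exact: TS|rewrite eTS].
by move=> /sub[/= _ <-] /sub[/= _ <-].
Qed.

Lemma closure_funP T : closeable T -> forall x y,
  closure (graph T) (x, y) -> closure_fun T x = y.
Proof.
move=> cT x y Txy; rewrite /closure_fun; case: xgetP => [z _ Txz|/(_ y)//].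
exact: closeable_functional Txz Txy.
Qed.

Lemma closure_fun_linear T : closeable T -> forall (a : K) (x y : H),
  closure_dom T x -> closure_dom T y ->
  closure_fun T (a *: x + y) = a *: closure_fun T x + closure_fun T y.
Proof.
move=> cT a x y [x' Tx] [y' Ty].
rewrite (closure_funP cT Tx) (closure_funP cT Ty).
by apply: closure_funP => //; exact: (graph_closure_lin (a := a) Tx Ty).
Qed.

(* The operator whose graph is the closure of the graph of T in H * H, see
   graph_op_closure below. *)
Definition op_closure T (cT : closeable T) : operator :=
  @Operator (closure_dom T) (closure_fun T) (closure_dom0 T)
    (@closure_domD T) (closure_fun_linear cT).

Lemma graph_op_closure T (cT : closeable T) :
  graph (op_closure cT) = closure (graph T).
Proof.
apply/seteqP; split => [[x y] [/= [z Txz] <-]|[x y] Txy].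
  by rewrite (closure_funP cT Txz).
by split => /=; [exists y|exact: closure_funP].
Qed.

End Operators.

(* Main.v *)
Require Import Defs.
From mathcomp Require Import all_boot all_order all_algebra.
From mathcomp Require Import all_classical all_reals all_analysis.

(** Two closed operators [S] and [T] on a complete space have a closed product
    as soon as [T] is bounded relatively to [S T]. Indeed, let [(x, z)] be a
    limit of pairs [(u, S (T u))]. Both [u] and [S (T u)] are Cauchy, so the
    relative bound, applied to differences, makes the middle term [T u] Cauchy
    as well; by completeness it has a limit [y]. Closedness of [T] along
    [(u, T u)] gives [T x = y], and closedness of [S] along [(T u, S (T u))]
    gives [S y = z]. This is [closed_op_mul], and it applies to the closures of
    [A] and [B].

    The inclusion then follows from the minimality of the closure
    ([op_closure_min]): the product of the closures is a closed operator, and it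
    extends [A B] because each closure extends the operator it comes from. *)

Set Implicit Arguments.
Unset Strict Implicit.
Unset Printing Implicit Defensive.

Import Order.TTheory GRing.Theory Num.Theory.
Import numFieldNormedType.Exports.

Local Open Scope classical_set_scope.
Local Open Scope ring_scope.

Section Extensions.
Variables (K : numFieldType) (H : normedModType K).
Implicit Types S T : operator H.

Lemma op_subP S T : op_sub S T <-> graph S `<=` graph T.
Proof.
split=> [[dST eST] [x y] [/= Sx <-]|sST].
  by split => /=; [exact: dST|rewrite eST].
by split=> x Sx; have [] := sST (x, S x) (conj Sx erefl).
Qed.

Lemma op_sub_closure T (cT : closeable T) : op_sub T (op_closure cT).
Proof. by apply/op_subP; rewrite graph_op_closure; exact: subset_closure. Qed.

Lemma op_closure_min S T (cT : closeable T) :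
  closed_op S -> op_sub T S -> op_sub (op_closure cT) S.
Proof.
move=> cS /op_subP sTS; apply/op_subP; rewrite graph_op_closure.
by apply: subset_trans cS; exact: closureS.
Qed.

Lemma closed_op_closure T (cT : closeable T) : closed_op (op_closure cT).
Proof. by rewrite /closed_op graph_op_closure; exact: closed_closure. Qed.

Lemma op_sub_mul S S' T T' :
  op_sub S S' -> op_sub T T' -> op_sub (op_mul S T) (op_mul S' T').
Proof.
move=> [dS eS] [dT eT]; split=> x /= [Tx STx]; rewrite -?eT ?eS//.
by split; [exact: dT|rewrite -eT//; exact: dS].
Qed.

Lemma op_funB T x y : op_dom T x -> op_dom T y -> T (x - y) = T x - T y.
Proof.
move=> Tx Ty; have := op_fun_linear (- 1) Ty Tx.
by rewrite !scaleN1r ![- _ + _]addrC.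
Qed.

Lemma op_domB T x y : op_dom T x -> op_dom T y -> op_dom T (x - y).
Proof. by move=> Tx Ty; rewrite addrC -scaleN1r; exact: op_domD. Qed.

End Extensions.

Section ClosedProduct.
Variables (K : numFieldType) (H : completeNormedModType K).
Implicit Types S T M : operator H.

(** Filters take the place of sequences [(u_n, M u_n)] converging to [p]. *)
Definition graph_approach M (p : H * H) := within (graph M) (nbhs p).

Lemma graph_approach_proper M p :
  closure (graph M) p -> ProperFilter (graph_approach M p).
Proof. by move=> Mp; apply: within_nbhs_proper. Qed.

(** The relative bound turns the Cauchy property of the pairs [(u, M u)] into
    that of [T u]. *)
Lemma cvg_op_bounded T M p : op_bounded_by T M -> closure (graph M) p ->
  cvg ((fun q => T q.1) @ graph_approach M p).
Proof.
move=> [dMT [a [b [a0 b0 TM]]]] Mp.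
have FF := graph_approach_proper Mp.
apply/cauchy_cvgP; apply: cauchy_exP => e e0.
(* Two points at distance less than d from p are less than d + d apart in each
   coordinate, and (a + b) (d + d) < e. *)
pose c := (a + b) * 2 + 1.
have c0 : 0 < c by rewrite ltr_wpDl ?mulr_ge0 ?addr_ge0.
pose d := e / c.
have d0 : 0 < d by rewrite divr_gt0.
have [q [[/= Mq Mq2] [qx qz]]] := Mp _ (nbhsx_ballx p d d0).
exists (T q.1).
suff : graph_approach M p [set r | ball (T q.1) e (T r.1)] by [].
apply: filterS (nbhsx_ballx p d d0) => r [rx rz] [/= Mr Mr2].
rewrite -ball_normE /= -op_funB; [|exact: dMT|exact: dMT].
apply: le_lt_trans (TM _ (op_domB Mq Mr)) _.
rewrite op_funB// Mq2 Mr2.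
have dist (u v w : H) : ball u d v -> ball u d w -> `|v - w| <= d *+ 2.
  move=> /ball_sym uv uw; have := ball_triangle uv uw.
  by rewrite -ball_normE/= -mulr2n => /ltW.
apply: (@le_lt_trans _ _ ((a + b) * (d *+ 2))).
  by rewrite mulrDl lerD// ler_wpM2l//; [exact: dist qx rx|exact: dist qz rz].
have -> : e = c * d by rewrite mulrC divfK ?gt_eqF.
by rewrite mulrnAr -mulrnAl -mulr_natr ltr_pM2r// ltrDl.
Qed.

(** Along one filter of pairs [(u, S (T u))], the points [u], [T u] and
    [S (T u)] all converge, so that the two closed graphs, which share the middle
    point, can be used one after the other. *)
Lemma closed_op_mul S T : closed_op S -> closed_op T ->
  op_bounded_by T (op_mul S T) -> closed_op (op_mul S T).
Proof.
move=> cS cT TST [x z] STxz.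
have FF := graph_approach_proper STxz.
have /cvg_ex[/= y Ty] := cvg_op_bounded TST STxz.
have F_id : graph_approach (op_mul S T) (x, z) --> (x, z).
  exact: cvg_within.
have Fx : q.1 @[q --> graph_approach (op_mul S T) (x, z)] --> x.
  by apply: cvg_comp F_id _; exact: cvg_fst.
have Fz : q.2 @[q --> graph_approach (op_mul S T) (x, z)] --> z.
  by apply: cvg_comp F_id _; exact: cvg_snd.
have graphF : \forall q \near graph_approach (op_mul S T) (x, z),
    graph (op_mul S T) q by exact: withinT.
have graphT : \forall q \near graph_approach (op_mul S T) (x, z),
    graph T (q.1, T q.1).
  by apply: filterS graphF => q [[Tq _] _].
have graphS : \forall q \near graph_approach (op_mul S T) (x, z),
    graph S (T q.1, q.2).
  by apply: filterS graphF => q [[_ STq] STq2].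
have [/= Tx Txy] : graph T (x, y).
  exact: (closed_cvg _ cT graphT (x, y) (cvg_pair Fx Ty)).
have [/= Sy Syz] : graph S (y, z).
  exact: (closed_cvg _ cS graphS (y, z) (cvg_pair Ty Fz)).
by split; rewrite /= ?/mul_dom /= Txy.
Qed.

End ClosedProduct.

Theorem lemma4 (R : realType) (k : scalar_kind)
    (H : completeNormedModType (scalar_field R k))
    (dot : {dot H for @scalar_conj R k}) (Hdot : inner_product_norm dot)
    (A B : operator H)
    (dA : densely_defined A) (dB : densely_defined B)
    (cA : closeable A) (cB : closeable B) (cAB : closeable (op_mul A B)) :
  op_bounded_by (op_closure cB) (op_mul (op_closure cA) (op_closure cB)) ->
  closed_op (op_mul (op_closure cA) (op_closure cB)) /\
  op_sub (op_closure cAB) (op_mul (op_closure cA) (op_closure cB)).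
Proof.
move=> bounded.
have closedAB : closed_op (op_mul (op_closure cA) (op_closure cB)).
  by apply: closed_op_mul bounded; exact: closed_op_closure.
split=> //; apply: op_closure_min closedAB _.
exact: op_sub_mul (op_sub_closure cA) (op_sub_closure cB).
Qed.
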